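(* Let $1\leq p<2$. Let $\omega$ be a continuous non-decreasing function on $[0,+\infty)$ with $\omega(0)=0$, and let $\varphi$ be a real function on an interval $I\subset\mathbb R$ of length $|I|<2\pi$. Suppose that $\varphi$ is nonlinear on $I$ and $\varphi\in C^{1,\omega}(I)$. Then there is a constant $c>0$, independent of $\lambda$, such that $$\|e^{i\lambda\varphi}\|_{A_p(\mathbb T,I)}\geq c\,|\lambda|^{1/p}\,\chi^{-1}(1/|\lambda|),\qquad \lambda\in\mathbb R,\quad |\lambda|\geq 1,$$ where $\chi^{-1}$ is the function inverse to $\chi(\delta)=\delta\,\omega(\delta)$.
   Context: ''Linear'' means affine, i.e. of the form $at+b$; ''nonlinear on $I$'' means not affine on $I$. $\mathbb T=\mathbb R/2\pi\mathbb Z$; functions on $\mathbb T$ are identified with $2\pi$-periodic functions on $\mathbb R$. Fourier coefficients: $\widehat f(k)=\frac1{2\pi}\int_0^{2\pi}f(t)e^{-ikt}\,dt$, $k\in\mathbb Z$. $A_1(\mathbb T)$ is the space of continuous functions $f$ on $\mathbb T$ with $\{\widehat f(k)\}\in l^1$; for $1<p\le 2$, $A_p(\mathbb T)$ is the space of integrable functions $f$ on $\mathbb T$ with $\{\widehat f(k)\}\in l^p$. The norm is $\|f\|_{A_p(\mathbb T)}=\big(\sum_{k\in\mathbb Z}|\widehat f(k)|^p\big)^{1/p}$. For an interval $I\subset\mathbb R$ of length less than $2\pi$, a function $f$ on $I$ belongs to $A_p(\mathbb T,I)$ if there is $F\in A_p(\mathbb T)$ whose restriction $F_{|I}$ to $I$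 coincides with $f$, and $\|f\|_{A_p(\mathbb T,I)}=\inf\{\|F\|_{A_p(\mathbb T)}: F\in A_p(\mathbb T),\ F_{|I}=f\}$. For a function $g$ on $I$, $\omega(I,g,\delta)=\sup\{|g(t_1)-g(t_2)|: t_1,t_2\in I,\ |t_1-t_2|\le\delta\}$. $\mathrm{Lip}_\omega(I)$ is the class of functions $g$ on $I$ with $\omega(I,g,\delta)=O(\omega(\delta))$ as $\delta\to+0$. $C^{1,\omega}(I)$ is the class of differentiable functions $g$ on $I$ with $g'\in\mathrm{Lip}_\omega(I)$. *)

(* Defs.v *)
From HB Require Import structures.
From mathcomp Require Import all_boot all_order all_algebra.
From mathcomp Require Import all_classical all_reals all_analysis.
From mathcomp Require Import complex.

Set Implicit Arguments.
Unset Strict Implicit.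
Unset Printing Implicit Defensive.

Import Order.TTheory GRing.Theory Num.Theory.
Import numFieldNormedType.Exports.

Local Open Scope classical_set_scope.
Local Open Scope ring_scope.

(* Complex-valued functions of a real variable are maps R -> R[i]; continuity,
   integrability and integrals of such maps are taken on real and imaginary
   parts. *)

(* e^{i theta} *)
Definition expi (R : realType) (theta : R) : R[i] :=
  Complex (cos theta) (sin theta).

Definition ccontinuous (R : realType) (F : R -> R[i]) : Prop :=
  continuous (fun t => complex.Re (F t)) /\
  continuous (fun t => complex.Im (F t)).

Definition cintegrable (R : realType) (D : set R) (F : R -> R[i]) : Prop :=
  lebesgue_measure.-integrable D (fun t => (complex.Re (F t))%:E) /\
  lebesgue_measure.-integrable D (fun t => (complex.Im (F t))%:E).

Definition cintegral (R : realType) (D : set R) (F : R -> R[i]) : R[i] :=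
  Complex (\int[lebesgue_measure]_(t in D) complex.Re (F t))
          (\int[lebesgue_measure]_(t in D) complex.Im (F t)).

Definition fourier_coef (R : realType) (F : R -> R[i]) (k : int) : R[i] :=
  Complex (2 * pi)^-1 0 *
  cintegral `[0, 2 * pi] (fun t => F t * expi (- (k%:~R * t))).

(* Values in \bar R: +oo when the coefficients of F are not in l^p. *)
Definition Ap_norm (R : realType) (p : R) (F : R -> R[i]) : \bar R :=
  ((\esum_(k in [set: int])
      (ComplexField.Normc.normc (fourier_coef F k) `^ p)%:E) `^ p^-1)%E.

(* A_p(T), for 1 <= p <= 2; functions on T are 2 pi-periodic functions on R. *)
Definition Ap (R : realType) (p : R) (F : R -> R[i]) : Prop :=
  [/\ periodic F (2 * pi),
      if p == 1 then ccontinuous F else cintegrable `[0, 2 * pi] F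
    & (Ap_norm p F < +oo)%E].

(* F restricted to I is f.  The elements of A_1(T) are continuous functions,
   so this is pointwise equality for p = 1; for p > 1 the elements of A_p(T)
   are integrable functions up to null sets, so it is equality a.e. *)
Definition restricts_to (R : realType) (p : R) (I : set R)
    (F f : R -> R[i]) : Prop :=
  if p == 1 then {in I, F =1 f}
  else {ae lebesgue_measure, forall t : R, I t -> F t = f t}.

(* Only the values of f on I matter.  The infimum is +oo if f is not in
   A_p(T, I). *)
Definition Ap_norm_on (R : realType) (p : R) (I : set R) (f : R -> R[i])
    : \bar R :=
  ereal_inf [set Ap_norm p F | F in [set F | Ap p F /\ restricts_to p I F f]].

Definition modulus (R : realType) (I : set R) (g : R -> R) (delta : R)
    : \bar R :=
  ereal_sup [set x | exists t1 t2 : R,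
    [/\ I t1, I t2, `|t1 - t2| <= delta & x = `|g t1 - g t2|%:E]].

Definition Lip_omega (R : realType) (omega : R -> R) (I : set R) (g : R -> R)
    : Prop :=
  exists C : R, \forall delta \near 0^'+,
    (modulus I g delta <= (C * omega delta)%:E)%E.

(* dg is the derivative of g on I, one-sided at endpoints belonging to I. *)
Definition is_derivative_on (R : realType) (I : set R) (g dg : R -> R) : Prop :=
  forall t, I t ->
    (fun s => (g s - g t) / (s - t)) @ within I t^' --> dg t.

Definition C1_omega (R : realType) (omega : R -> R) (I : set R) (g : R -> R)
    : Prop :=
  exists dg : R -> R, is_derivative_on I g dg /\ Lip_omega omega I dg.

(* "Linear" in the sense of affine. *)
Definition linear_on (R : realType) (I : set R) (g : R -> R) : Prop :=
  exists a b : R, forall t, I t -> g t = a * t + b.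

Definition chi (R : realType) (omega : R -> R) (delta : R) : R :=
  delta * omega delta.

(* Inverse of chi : [0, +oo) -> [0, +oo); chi is such a bijection as soon as
   omega is continuous, non-decreasing and positive on (0, +oo). *)
Definition chi_inv (R : realType) (omega : R -> R) : R -> R :=
  'pinv_(fun=> 0) [set delta : R | 0 <= delta] (chi omega).

(* Main.v *)
Require Import Defs.
From HB Require Import structures.
From mathcomp Require Import all_boot all_order all_algebra.
From mathcomp Require Import all_classical all_reals all_analysis.
From mathcomp Require Import complex.
From mathcomp Require Import measurable_realfun ring lra.

Import Order.TTheory GRing.Theory Num.Theory.
Import numFieldNormedType.Exports.

Local Open Scope classical_set_scope.
Local Open Scope ring_scope.

Set Implicit Arguments.
Unset Strict Implicit.

(** Let F extend e^{i lambda phi} from I.  At the scale delta for which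
    |lambda| delta omega(delta) = 1, the phase lambda phi stays within O(1) of
    its tangent line at t on a window of length delta around t; on a window of
    length 2h, with 2h a small fixed multiple of delta, the deviation is at most
    1/2.  Hence, if k is an integer within distance 1 of lambda phi'(t), the
    argument of F(u) e^{-iku} stays within 1 of a constant on that window
    (resonant_window), and the integral of this product against a tent function
    of half-width h carried by the window has modulus at least of order h^2
    (int_tent_ge).  Since phi' is continuous and not
    constant, lambda phi' covers an interval of length proportional to |lambda|,
    so this happens for at least c |lambda| integers k (integer_frequencies).

    On the Fourier side this integral is the convolution, evaluated at k, of the
    coefficients of F with those of the tent.  The coefficients of a tent have
    moduli that do not depend on its position, and these moduli add up to its
    height h.  So one fixed l^1 sequence of mass O(h), convolved with |F^|, is at
    least of order h^2 at c |lambda| integers, and the inequality of Young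
    for l^1 * l^p (discrete_young) gives a lower bound of order |lambda|^{1/p} h
    for the l^p norm of F^ (Ap_norm_ge).  Here h is proportional to
    delta = chi^{-1}(1/|lambda|).

    As F is only known to be integrable, its Fourier series is never summed.
    Only the tent is expanded, and it is replaced by a trigonometric polynomial
    that is uniformly close to it (tent_approx).  This rests on the identity
    sum_n cos(nx)/n^2 = x^2/4 - pi x/2 + const on [0, 2 pi], because the symmetric
    second difference of the right-hand side, extended evenly, is a tent up to
    a factor and an additive constant. *)

(** * The cosine series of a parabola *)

Lemma sin_nat_pi {R : realType} n : sin (n%:R * pi) = 0 :> R.
Proof.
elim: n => [|n IH]; first by rewrite mul0r sin0.
by rewrite -natr1 mulrDl mul1r sinDpi IH oppr0.
Qed.

Lemma cos_nat_2pi {R : realType} n (x : R) : cos (n%:R * (2 * pi) + x) = cos x.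
Proof.
elim: n => [|n IH]; first by rewrite mul0r add0r.
rewrite -natr1 mulrDl mul1r addrAC -IH -[RHS]cosD2pi.
by rewrite !mulr_natl.
Qed.

Definition cos_series {R : realType} N (x : R) : R :=
  \sum_(i < N) cos (i.+1%:R * x) / i.+1%:R ^+ 2.

(** Minus the derivative of cos_series - bern; it converges to 0 on the open
    interval from 0 to 2 pi. *)
Definition saw_series {R : realType} N (x : R) : R :=
  \sum_(i < N) sin (i.+1%:R * x) / i.+1%:R - (pi - x) / 2.

(** Up to scaling and an additive constant, the second Bernoulli polynomial
    of x / (2 pi). *)
Definition bern {R : realType} (x : R) : R := x ^+ 2 / 4 - pi * x / 2.

Lemma dirichlet_kernel {R : realType} N (x : R) :
  2 * sin (x / 2) * (\sum_(i < N) cos (i.+1%:R * x) + 2^-1)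
  = sin ((N%:R + 2^-1) * x).
Proof.
elim: N => [|N IH].
  by rewrite big_ord0 !add0r mulrAC divff ?mul1r // mulrC.
rewrite big_ord_recr /= addrAC mulrDr IH.
have -> : (N.+1%:R + 2^-1) * x = N.+1%:R * x + x / 2 by rewrite mulrDl (mulrC 2^-1).
have -> : (N%:R + 2^-1) * x = N.+1%:R * x - x / 2 by rewrite -natr1; field.
rewrite sinB sinD; ring.
Qed.

Lemma is_derive_cos_lin {R : realType} (a x : R) :
  is_derive x 1 (fun t => cos (a * t)) (- (a * sin (a * x))).
Proof.
have h : is_derive x 1 (fun t => a * t) a.
  by apply: is_derive_eq; rewrite /GRing.scale /= mulr1.
apply: (@is_derive_eq _ _ _ _ _ _ _ _ (is_derive1_comp _ _)).
by rewrite mulNr mulrC.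
Qed.

Lemma is_derive_sin_lin {R : realType} (a x : R) :
  is_derive x 1 (fun t => sin (a * t)) (a * cos (a * x)).
Proof.
have h : is_derive x 1 (fun t => a * t) a.
  by apply: is_derive_eq; rewrite /GRing.scale /= mulr1.
apply: (@is_derive_eq _ _ _ _ _ _ _ _ (is_derive1_comp _ _)).
by rewrite mulrC.
Qed.

Lemma is_derive_cos_series {R : realType} N (x : R) :
  is_derive x 1 (fun t => cos_series N t - bern t) (- saw_series N x).
Proof.
have dsum : is_derive x 1 (cos_series N) (- \sum_(i < N) sin (i.+1%:R * x) / i.+1%:R).
  have -> : cos_series N =
      \sum_(i < N) (fun t : R => (i.+1%:R ^+ 2)^-1 *: (cos (i.+1%:R * t) : R^o)).
    by apply/funext => t; rewrite fct_sumE; apply: eq_bigr => i _;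
       rewrite /GRing.scale /= mulrC.
  apply: is_derive_eq.
  rewrite -sumrN; apply: eq_bigr => i _; rewrite /GRing.scale /=.
  have : i.+1%:R != 0 :> R by rewrite pnatr_eq0.
  by move: (i.+1%:R) => c c0; field.
have dq : is_derive x 1 bern (x / 2 - pi / 2).
  rewrite /bern; apply: is_derive_eq.
  by rewrite /GRing.scale /=; field.
apply: is_derive_eq.
by rewrite /saw_series; field.
Qed.

Lemma is_derive_saw_series {R : realType} N (x : R) :
  is_derive x 1 (saw_series N) (\sum_(i < N) cos (i.+1%:R * x) + 2^-1).
Proof.
have dsum : is_derive x 1 (fun t : R => \sum_(i < N) sin (i.+1%:R * t) / i.+1%:R)
    (\sum_(i < N) cos (i.+1%:R * x)).
  have -> : (fun t : R => \sum_(i < N) sin (i.+1%:R * t) / i.+1%:R) =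
      \sum_(i < N) (fun t : R => (i.+1%:R)^-1 *: (sin (i.+1%:R * t) : R^o)).
    by apply/funext => t; rewrite fct_sumE; apply: eq_bigr => i _;
       rewrite /GRing.scale /= mulrC.
  apply: is_derive_eq.
  apply: eq_bigr => i _; rewrite /GRing.scale /=.
  have : i.+1%:R != 0 :> R by rewrite pnatr_eq0.
  by move: (i.+1%:R) => c c0; field.
rewrite /saw_series; apply: is_derive_eq.
by rewrite /GRing.scale /=; field.
Qed.

Lemma MVT_bound {R : realType} (f df : R -> R) (a b M : R) : a <= b ->
  (forall x, a <= x <= b -> is_derive x 1 f (df x)) ->
  (forall x, a <= x <= b -> `|df x| <= M) ->
  `|f b - f a| <= M * (b - a).
Proof.
move=> ab fdf dfM.
have [||c] := @MVT_segment _ f df a b ab.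
- by move=> x /andP[/= ax xb]; apply: fdf; rewrite !ltW.
- apply: derivable_within_continuous => x; rewrite in_itv /= => xab.
  by have [] := fdf x xab.
rewrite in_itv /= => cab ->.
by rewrite normrM (ger0_norm (x := b - a)) ?subr_ge0 // ler_wpM2r ?subr_ge0 // dfM.
Qed.

Lemma sin_half_ge {R : realType} (x t : R) : 0 < x -> x <= t -> t <= pi ->
  0 < sin (2^-1 * x) <= sin (2^-1 * t).
Proof.
move=> x0 xt tpi; have pi0 := pi_gt0 R.
rewrite sin_gt0_pi /=; last by apply/andP; split; lra.
have [->|xt'] := eqVneq x t; first by [].
apply: ltW; rewrite ltr_sin ?in_itv /=; try (apply/andP; split; lra).
have : x < t by rewrite lt_neqAle xt'.
lra.
Qed.

Lemma saw_series_pi {R : realType} N : saw_series N pi = 0 :> R.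
Proof.
rewrite /saw_series subrr mul0r subr0 big1 // => i _.
by rewrite sin_nat_pi mul0r.
Qed.

(** The derivative of saw_series is the Dirichlet kernel
    sin(ct) / (2 sin(t/2)), c = N + 1/2.  Adding to saw_series the small function
    v = cos(ct) / (2c sin(t/2)), which is what integrating the oscillating factor
    by parts produces, leaves a derivative that is itself O(1/N) away from 0; the
    mean value theorem between t and pi, where saw_series vanishes, concludes. *)
Lemma saw_series_bound {R : realType} N (x t : R) : 0 < x -> x <= t -> t <= pi ->
  `|saw_series N t| <= (pi / sin (2^-1 * x) ^+ 2 + 2 / sin (2^-1 * x)) / N.+1%:R.
Proof.
move=> x0 xt tpi.
set sg := sin (2^-1 * x).
have pi0 := pi_gt0 R.
have sg0 : 0 < sg by have /andP[] := @sin_half_ge R x x x0 (lexx _) (le_trans xt tpi).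
pose c : R := N%:R + 2^-1.
have c0 : 0 < c by rewrite /c ltr_wpDl.
pose v (u : R) := (2 * c)^-1 * (cos (c * u) * (sin (2^-1 * u))^-1).
have vb u : x <= u -> u <= pi -> `|v u| <= (2 * c)^-1 / sg.
  move=> xu upi; have /andP[_ su] := sin_half_ge x0 xu upi.
  rewrite /v normrM ger0_norm; last by rewrite invr_ge0 mulr_ge0 // ltW.
  rewrite ler_wpM2l ?invr_ge0 ?mulr_ge0 ?(ltW c0) //.
  rewrite normrM normfV.
  have s0 : 0 < sin (2^-1 * u) by exact: lt_le_trans su.
  rewrite (ger0_norm (ltW s0)) -[leRHS]mul1r ler_pM ?invr_ge0 ?normr_ge0 ?(ltW s0) ?cos_max //.
  by rewrite lef_pV2 ?posrE.
pose dG (u : R) := - (cos (c * u) * cos (2^-1 * u)) / (4 * c * sin (2^-1 * u) ^+ 2).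
have dGP u : t <= u <= pi -> is_derive u 1 (fun u => saw_series N u + v u) (dG u).
  move=> /andP[tu upi]; have /andP[s0 su] := sin_half_ge x0 (le_trans xt tu) upi.
  have s0' := lt_le_trans s0 su.
  have h1 := is_derive_saw_series N u.
  have h2 := is_derive_cos_lin c u.
  have h3 := is_derive_sin_lin (2^-1) u.
  have h4 := @is_deriveV _ (fun z => sin (2^-1 * z)) u _ _ (lt0r_neq0 s0') h3.
  have := dirichlet_kernel N u; rewrite -/c [u / 2]mulrC.
  set D := _ + 2^-1 => DE.
  rewrite /v; apply: is_derive_eq.
  rewrite /GRing.scale /= -/D /dG.
  have DE' : D = sin (c * u) / (2 * sin (2^-1 * u)).
    by rewrite -DE mulrAC divff ?mul1r // mulf_neq0 // lt0r_neq0.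
  rewrite DE'; field; by rewrite !lt0r_neq0.
have dGb u : t <= u <= pi -> `|dG u| <= (4 * c * sg ^+ 2)^-1.
  move=> /andP[tu upi]; have /andP[s0 su] := sin_half_ge x0 (le_trans xt tu) upi.
  have s0' := lt_le_trans s0 su.
  rewrite /dG normrM normrN normrM normfV -[leRHS]mul1r ler_pM //.
  - by rewrite -[leRHS]mulr1 ler_pM // cos_max.
  - rewrite ger0_norm ?mulr_ge0 ?sqr_ge0 ?(ltW c0) ?(ltW s0') //.
    rewrite lef_pV2 ?posrE ?mulr_gt0 ?exprn_gt0 //.
    rewrite ler_wpM2l ?mulr_ge0 ?(ltW c0) // lerXn2r ?nnegrE ?(ltW sg0) //; exact: ltW.
have := MVT_bound tpi dGP dGb.
rewrite saw_series_pi add0r => hG.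
have vt := vb t xt tpi; have vpi := vb pi (le_trans xt tpi) (lexx _).
have : `|saw_series N t| <= (4 * c * sg ^+ 2)^-1 * pi + (2 * c)^-1 / sg * 2.
  have hpi : (4 * c * sg ^+ 2)^-1 * (pi - t) <= (4 * c * sg ^+ 2)^-1 * pi.
    rewrite ler_wpM2l ?invr_ge0 ?mulr_ge0 ?(ltW sg0) ?(ltW c0) //.
    by rewrite gerBl (le_trans (ltW x0) xt).
  move: hG vt vpi hpi; rewrite !ler_norml; lra.
move=> /le_trans; apply.
have N0 : 0 < N.+1%:R :> R by rewrite ltr0n.
have cN : N.+1%:R <= 2 * c.
  by rewrite /c -natr1 mulrDr divff // mulr_natl mulr2n -addrA lerD2l lerDr.
have cV : (2 * c)^-1 <= N.+1%:R^-1 by rewrite lef_pV2 ?posrE ?mulr_gt0.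
have -> : (4 * c * sg ^+ 2)^-1 * pi + (2 * c)^-1 / sg * 2 =
   (pi / sg ^+ 2 / 2 + 2 / sg) * (2 * c)^-1.
  by field; rewrite !lt0r_neq0.
have P0 : 0 <= pi / sg ^+ 2 by rewrite divr_ge0 ?sqr_ge0 // ltW.
have P1 : 0 <= 2 / sg by rewrite divr_ge0 // ltW.
rewrite ler_pM ?invr_ge0 ?addr_ge0 //; first by rewrite divr_ge0.
  by rewrite mulr_ge0 // ltW.
by rewrite lerD2r ler_pdivrMr // ler_peMr // ler1n.
Qed.

(** Comparison with the value at pi avoids computing the additive constant of
    the limit, which cancels later in second differences. *)
Lemma cos_series_conv {R : realType} (x : R) : 0 < x <= pi ->
  exists C : R, forall N,
    `|(cos_series N x - bern x) - (cos_series N pi - bern pi)| <= C / N.+1%:R.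
Proof.
move=> /andP[x0 xpi].
exists ((pi / sin (2^-1 * x) ^+ 2 + 2 / sin (2^-1 * x)) * (pi - x)) => N.
rewrite distrC mulrAC.
apply: (MVT_bound xpi (fun u _ => is_derive_cos_series N u)) => u /andP[xu upi].
by rewrite normrN saw_series_bound.
Qed.

(** Telescoping bound 1/n^2 <= 1/(n-1) - 1/n. *)
Lemma cos_series_tail {R : realType} (x : R) N K :
  `|cos_series (N.+1 + K) x - cos_series N.+1 x| <= N.+1%:R^-1 - (N.+1 + K)%:R^-1.
Proof.
elim: K => [|K IH]; first by rewrite addn0 !subrr normr0.
rewrite addnS {1}/cos_series big_ord_recr /= -/(cos_series (N.+1 + K) x) addrAC.
apply: (le_trans (ler_normD _ _)).
have h1 : 0 < (N.+1 + K)%:R :> R by rewrite ltr0n.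
have h2 : 0 < (N.+1 + K).+1%:R :> R by rewrite ltr0n.
have : `|cos ((N.+1 + K).+1%:R * x) / (N.+1 + K).+1%:R ^+ 2| <=
   (N.+1 + K)%:R^-1 - (N.+1 + K).+1%:R^-1 :> R.
  rewrite normrM normfV (ger0_norm (sqr_ge0 _)).
  have -> : (N.+1 + K)%:R^-1 - (N.+1 + K).+1%:R^-1 =
     ((N.+1 + K)%:R * (N.+1 + K).+1%:R)^-1 :> R.
    move: h1 h2; rewrite -[(N.+1 + K).+1%:R]natr1; move: (_%:R) => a a0 a1.
    by field; rewrite !lt0r_neq0.
  rewrite -[leRHS]mul1r ler_pM ?cos_max ?invr_ge0 ?sqr_ge0 //.
  rewrite lef_pV2 ?posrE ?mulr_gt0 ?exprn_gt0 // expr2 ler_wpM2r ?ltW //.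
  by rewrite ltr_nat.
by move=> h; apply: (le_trans (lerD IH h)); rewrite addrA subrK.
Qed.

(** The constant of cos_series_conv blows up as x tends to 0.  Letting the number
    of terms tend to infinity in it and bounding the tail by cos_series_tail
    gives a rate that is uniform in x. *)
Lemma cos_series_bern_pos {R : realType} N (x : R) : 0 < x <= pi ->
  `|(cos_series N.+1 x - bern x) - (cos_series N.+1 pi - bern pi)| <= 2 / N.+1%:R.
Proof.
move=> xpi; have [C hC] := cos_series_conv xpi.
apply/ler_addgt0Pl => e e0.
pose K := Num.truncn (C / e).
have := hC (N.+1 + K)%N.
have t1 := cos_series_tail x N K; have t2 := @cos_series_tail R pi N K.
have hK : C / (N.+1 + K).+1%:R <= e.
  rewrite ler_pdivrMr ?ltr0n // mulrC -ler_pdivrMr //.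
  apply: (le_trans (ltW (truncnS_gt _))).
  by rewrite ler_nat ltnS leq_addl.
have p0 : 0 <= (N.+1 + K)%:R^-1 :> R by rewrite invr_ge0.
move: t1 t2 hK p0; rewrite !ler_norml.
by move: (N.+1%:R^-1) ((N.+1 + K)%:R^-1) (C / (N.+1 + K).+1%:R) => a b c; lra.
Qed.

Lemma cos_series_sym {R : realType} N (x : R) : cos_series N (2 * pi - x) = cos_series N x.
Proof.
apply: eq_bigr => i _; congr (_ / _).
by rewrite mulrBr cos_nat_2pi cosN.
Qed.

(** The end point 0 is reached by continuity, since the bound is uniform, and
    the segment from pi to 2 pi by the symmetry about pi. *)
Lemma cos_series_bern {R : realType} N (x : R) : 0 <= x <= 2 * pi ->
  `|(cos_series N.+1 x - bern x) - (cos_series N.+1 pi - bern pi)| <= 2 / N.+1%:R.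
Proof.
wlog xpi : x / x <= pi.
  move=> H /andP[x0 x2]; have [xpi|pix] := leP x pi; first by apply: H => //; rewrite x0.
  have := H (2 * pi - x); rewrite cos_series_sym.
  have -> : bern (2 * pi - x) = bern x by rewrite /bern; field.
  apply; first by lra.
  by apply/andP; split; lra.
move=> /andP[]; rewrite le_eqVlt => /orP[/eqP <- _|x0 _]; last first.
  by apply: cos_series_bern_pos; rewrite x0.
have pi0 := pi_gt0 R.
pose f : R -> R := fun x =>
  `|(cos_series N.+1 x - bern x) - (cos_series N.+1 pi - bern pi)|.
have fc : f y @[y --> 0^'+] --> f 0.
  apply: cvg_at_right_filter; apply: cvg_norm; apply: cvgB; last exact: cvg_cst.
  have [/derivable1_diffP/differentiable_continuous + _] :=
    is_derive_cos_series N.+1 (0 : R).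
  exact.
apply: (cvgr_to_le fc).
near=> y; apply: cos_series_bern_pos; apply/andP; split.
  near: y; exact: nbhs_right_gt.
near: y; exact: nbhs_right_le.
Unshelve. all: by end_near. Qed.

(** * Trigonometric approximation of tent functions *)

Definition tent {R : realType} (h x : R) : R := Num.max (h - `|x|) 0.

(** The cosine coefficients of the 2 pi-periodic tent. *)
Definition tent_weight {R : realType} (h : R) (n : nat) : R :=
  2 * (1 - cos (n%:R * h)) / (pi * n%:R ^+ 2).

Definition tent_sum {R : realType} (h : R) N (x : R) : R :=
  h ^+ 2 / (2 * pi) + \sum_(i < N) tent_weight h i.+1 * cos (i.+1%:R * x).

Lemma cos_series_norm {R : realType} N (x : R) : cos_series N `|x| = cos_series N x.
Proof.
apply: eq_bigr => i _; rewrite -[in RHS]cos_norm normrM.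
by rewrite (ger0_norm (ler0n _ _)).
Qed.

(** Because cos(n(x+h)) + cos(n(x-h)) = 2 cos(nx) cos(nh), the partial sums for
    the tent are second differences of those for the parabola. *)
Lemma tent_sumE {R : realType} (h : R) N x :
  tent_sum h N x = h ^+ 2 / (2 * pi) +
    pi^-1 * (2 * cos_series N x - cos_series N (x + h) - cos_series N (x - h)).
Proof.
congr (_ + _); rewrite /cos_series mulr_sumr -!sumrB mulr_sumr.
apply: eq_bigr => i _; rewrite /tent_weight (mulrDr _ x h) (mulrBr _ x h) cosB cosD.
have c0 : i.+1%:R != 0 :> R by rewrite pnatr_eq0.
have pi0 := lt0r_neq0 (pi_gt0 R).
by move: (i.+1%:R) c0 (@pi R) pi0 => c c0 q q0; field; rewrite c0 q0.
Qed.

(** The quadratic part of bern contributes -h^2 / (2 pi), which cancels the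
    constant term; its linear part contributes (|x+h| + |x-h| - 2|x|) / 2, which
    is the tent. *)
Lemma tent_bern {R : realType} (h x : R) : 0 < h ->
  tent h x = h ^+ 2 / (2 * pi) +
    pi^-1 * (2 * bern `|x| - bern `|x + h| - bern `|x - h|).
Proof.
move=> h0; have pi0 := lt0r_neq0 (pi_gt0 R).
wlog x0 : x / 0 <= x.
  move=> H; have [|xlt] := leP 0 x; first exact: H.
  have := H (- x); rewrite oppr_ge0 (ltW xlt) => /(_ isT).
  rewrite /tent normrN => ->.
  have -> : `|- x + h| = `|x - h| by rewrite addrC distrC.
  have -> : `|- x - h| = `|x + h| by rewrite -opprD normrN.
  by rewrite [_ - bern `|x - h| - _]addrAC.
rewrite /tent (ger0_norm x0) (ger0_norm (addr_ge0 x0 (ltW h0))) /bern.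
move: (@pi R) pi0 => q q0.
have [xh|hx] := leP x h.
- have -> : `|x - h| = h - x by rewrite distrC ger0_norm // subr_ge0.
  by rewrite max_l ?subr_ge0 //; field.
- have -> : `|x - h| = x - h by rewrite ger0_norm // subr_ge0 ltW.
  by rewrite max_r ?subr_le0 1?ltW //; field.
Qed.

(** The condition on x keeps x - h and x + h in the range from -2 pi to 2 pi,
    where the even extension of the parabola is valid. *)
Lemma tent_approx {R : realType} (h : R) N x : 0 < h -> `|x| <= 2 * pi - h ->
  `|tent_sum h N.+1 x - tent h x| <= 8 / pi / N.+1%:R.
Proof.
move=> h0 xh; have pi0 := pi_gt0 R.
have e (y : R) : `|y| <= 2 * pi -> `|(cos_series N.+1 y - bern `|y|) -
    (cos_series N.+1 pi - bern (pi : R))| <= 2 / N.+1%:R.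
  by move=> yb; rewrite -cos_series_norm cos_series_bern // normr_ge0.
have e1 : `|x| <= 2 * pi by lra.
have e2 : `|x + h| <= 2 * pi by move: xh; rewrite !ler_norml; lra.
have e3 : `|x - h| <= 2 * pi by move: xh; rewrite !ler_norml; lra.
move: (e _ e1) (e _ e2) (e _ e3) => {e e1 e2 e3}.
rewrite tent_sumE tent_bern //.
move: (cos_series _ (x - h)) (cos_series _ (x + h)) (cos_series _ x) (cos_series _ pi) => a b c d.
move: (bern `|x - h|) (bern `|x + h|) (bern `|x|) (bern pi) => a' b' c' d' e1 e2 e3.
rewrite opprD addrACA subrr add0r -mulrBr normrM ger0_norm ?invr_ge0 ?(ltW pi0) //.
rewrite -(mulrC pi^-1) -(mulrA pi^-1) ler_wpM2l ?invr_ge0 ?(ltW pi0) //.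
move: e1 e2 e3; move: (N.+1%:R^-1) => w; rewrite !ler_norml; lra.
Qed.

Lemma tent_weight_ge0 {R : realType} (h : R) n : 0 <= tent_weight h n.
Proof. by rewrite divr_ge0 ?mulr_ge0 ?subr_ge0 ?cos_le1 ?pi_ge0. Qed.

Lemma continuous_lin {R : realType} (a b : R) : continuous (fun u : R => a * u + b).
Proof. by move=> u; apply: cvgD; [apply: cvgM; [exact: cvg_cst|exact: cvg_id]|exact: cvg_cst]. Qed.

Lemma continuous_coslin {R : realType} (a b : R) : continuous (fun u : R => cos (a * u + b)).
Proof. by move=> u; apply: continuous_comp; [exact: continuous_lin|exact: continuous_cos]. Qed.

Lemma continuous_sinlin {R : realType} (a b : R) : continuous (fun u : R => sin (a * u + b)).
Proof. by move=> u; apply: continuous_comp; [exact: continuous_lin|exact: continuous_sin]. Qed.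

(** The pairs (coefficient, frequency) of tent_sum h N in complex form; a
    list makes a convolution at k the sum of j.1 * x (k - j.2). *)
Fixpoint tent_spec {R : realType} (h : R) (N : nat) : seq (R * int) :=
  if N is N'.+1 then
    (tent_weight h N / 2, N%:Z) :: (tent_weight h N / 2, - N%:Z) :: tent_spec h N'
  else [:: (h ^+ 2 / (2 * pi), 0)].

Lemma tent_spec_ge0 {R : realType} (h : R) N j : j \in tent_spec h N -> 0 <= j.1.
Proof.
elim: N => [|N IH] /=; rewrite !inE.
  by move=> /eqP -> /=; rewrite divr_ge0 ?sqr_ge0 ?mulr_ge0 ?pi_ge0.
by move=> /or3P[/eqP ->|/eqP ->|/IH //] /=; rewrite divr_ge0 ?tent_weight_ge0.
Qed.

Lemma tent_sumS {R : realType} (h x : R) N :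
  tent_sum h N.+1 x = tent_sum h N x + tent_weight h N.+1 * cos (N.+1%:R * x).
Proof. by rewrite /tent_sum big_ord_recr addrA. Qed.

Lemma tent_spec_sum {R : realType} (h : R) N : \sum_(j <- tent_spec h N) j.1 = tent_sum h N 0.
Proof.
elim: N => [|N IH]; first by rewrite big_seq1 /tent_sum big_ord0 addr0.
by rewrite /= !big_cons IH tent_sumS mulr0 cos0 mulr1 /=; field.
Qed.

(** The coefficients are nonnegative, so their sum is the value at 0, which is
    close to the height h of the tent. *)
Lemma tent_spec_mass {R : realType} (h : R) N : 0 < h -> h <= 2 * pi ->
  8 / pi / N.+1%:R <= h -> \sum_(j <- tent_spec h N.+1) j.1 <= 2 * h.
Proof.
move=> h0 hpi hN; rewrite tent_spec_sum.
have := @tent_approx R h N 0 h0; rewrite normr0 subr_ge0 => /(_ hpi).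
by rewrite /tent normr0 subr0 max_l ?(ltW h0) // ler_norml;
  move: (8 / pi / N.+1%:R) hN => e; lra.
Qed.

Lemma continuous_tent_sum {R : realType} (h s : R) N :
  continuous (fun u : R => tent_sum h N (u - s)).
Proof.
elim: N => [|N IH].
  have -> : (fun u : R => tent_sum h 0 (u - s)) = cst (h ^+ 2 / (2 * pi)).
    by apply/funext => u; rewrite /tent_sum big_ord0 addr0.
  exact: cst_continuous.
have -> : (fun u : R => tent_sum h N.+1 (u - s)) =
  (fun u => tent_sum h N (u - s) +
     tent_weight h N.+1 * cos (N.+1%:R * u + - (N.+1%:R * s))).
  by apply/funext => u; rewrite tent_sumS mulrBr.
move=> u; apply: cvgD; first exact: IH.
by apply: cvgM; [exact: cvg_cst|exact: continuous_coslin].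
Qed.

Lemma continuous_tent {R : realType} (h s : R) : continuous (fun u : R => tent h (u - s)).
Proof.
have c1 : continuous (fun u : R => h - `|u - s|).
  move=> u; apply: cvgB; first exact: cvg_cst.
  by apply: cvg_norm; apply: cvgB; [exact: cvg_id|exact: cvg_cst].
have -> : (fun u : R => tent h (u - s)) =
    (fun u => (h - `|u - s| + `|h - `|u - s| |) * 2^-1).
  by apply/funext => u; rewrite /tent maxr_absE addr0 subr0.
move=> u; apply: cvgM; last exact: cvg_cst.
by apply: cvgD; [exact: c1|apply: cvg_norm; exact: c1].
Qed.

(** * A discrete convolution inequality *)

(** The graph of the convex function x^p lies above its tangent at y.  For p > 1
    this is the inequality of Young for x and y^(p-1). *)
Lemma powR_tangent {R : realType} (p x y : R) : 1 <= p -> 0 <= x -> 0 < y ->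
  p * y `^ (p - 1) * x - (p - 1) * y `^ p <= x `^ p.
Proof.
move=> p1 x0 y0; rewrite lerBlDr.
have p0 : 0 < p by lra.
have [->|pn1] := eqVneq p 1.
  by rewrite subrr powRr0 mul0r addr0 !mul1r powRr1.
have p1' : 0 < p - 1 by rewrite subr_gt0 lt_neqAle eq_sym pn1.
pose q := p / (p - 1).
have q0 : 0 < q by rewrite divr_gt0.
have pq : p^-1 + q^-1 = 1 by rewrite /q; field; rewrite !lt0r_neq0.
have := conjugate_powR x0 (powR_ge0 y (p - 1)) p0 q0 pq.
rewrite -powRrM.
have -> : (p - 1) * q = p by rewrite /q; field; rewrite lt0r_neq0.
move=> h; have := ler_wpM2l (ltW p0) h.
rewrite (mulrC x) mulrA => /le_trans; apply.
rewrite le_eqVlt; apply/orP; left; apply/eqP.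
by rewrite /q; field; rewrite !lt0r_neq0.
Qed.

(** A weak form of the inequality ||d * x||_p <= ||d||_1 ||x||_p, for a finitely
    supported d: if the convolution is at least eta on K, then x cannot be small
    in l^p.  Instead of the Jensen inequality, powR_tangent is used at the single
    point y = eta / D: averaged against d, it bounds the convolution of d and x^p
    from below by D y^p at each point of K. *)
Lemma discrete_young {R : realType} (p : R) (r : seq (R * int)) (x : int -> R)
    (K : seq int) (D eta S : R) :
  1 <= p -> (forall k, 0 <= x k) ->
  (forall j, j \in r -> 0 <= j.1) -> 0 < D -> \sum_(j <- r) j.1 <= D -> 0 < eta ->
  (forall k, k \in K -> eta <= \sum_(j <- r) j.1 * x (k - j.2)) ->
  (forall m, \sum_(k <- K) x (k - m) `^ p <= S) ->
  (size K)%:R * (eta / D) `^ p <= S.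
Proof.
move=> p1 x0 r0 D0 rD eta0 hK hS.
set y := eta / D; have y0 : 0 < y by rewrite divr_gt0.
have S0 : 0 <= S by apply: le_trans (hS 0); apply: sumr_ge0 => k _; exact: powR_ge0.
have yp : y `^ (p - 1) * eta = y `^ p * D.
  have -> : eta = y * D by rewrite /y divfK ?lt0r_neq0.
  rewrite mulrA -{2}(powRr1 (ltW y0)) -powRD ?subrK //.
  by rewrite (gt_eqF y0) implybT.
have key k : k \in K -> y `^ p * D <= \sum_(j <- r) j.1 * x (k - j.2) `^ p.
  move=> kK; have := hK k kK; set sx := \sum_(j <- r) _ => hsx.
  apply: (@le_trans _ _ (\sum_(j <- r)
      j.1 * (p * y `^ (p - 1) * x (k - j.2) - (p - 1) * y `^ p))); last first.
    rewrite !big_seq; apply: ler_sum => j jr.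
    by rewrite ler_wpM2l ?r0 // powR_tangent.
  have -> : \sum_(j <- r) j.1 * (p * y `^ (p - 1) * x (k - j.2) - (p - 1) * y `^ p) =
     p * y `^ (p - 1) * sx - (p - 1) * y `^ p * \sum_(j <- r) j.1.
    rewrite /sx !mulr_sumr -sumrB; apply: eq_bigr => j _; ring.
  apply: (@le_trans _ _ (p * y `^ (p - 1) * eta - (p - 1) * y `^ p * D)).
    by rewrite -(mulrA p) yp le_eqVlt; apply/orP; left; apply/eqP; ring.
  apply: lerB.
    by rewrite ler_wpM2l // mulr_ge0 ?powR_ge0 //; lra.
  by rewrite ler_wpM2l // mulr_ge0 ?powR_ge0 // subr_ge0.
have : \sum_(k <- K) y `^ p * D <= \sum_(k <- K) \sum_(j <- r) j.1 * x (k - j.2) `^ p.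
  by rewrite !big_seq; apply: ler_sum => k; exact: key.
rewrite exchange_big /= big_const_seq count_predT iter_addr_0 => h.
rewrite -(ler_pM2r D0) -mulrA mulr_natl; apply: (le_trans h).
apply: (@le_trans _ _ (\sum_(j <- r) j.1 * S)).
  rewrite !big_seq; apply: ler_sum => j jr.
  by rewrite -mulr_sumr ler_wpM2l ?r0.
by rewrite -mulr_suml mulrC ler_wpM2l.
Qed.

(** * Integrals against tent functions *)

Local Notation circle := (`[0, 2 * pi]%classic).

Lemma circle_integrableM {R : realType} (f g : R -> R) :
  lebesgue_measure.-integrable circle (EFin \o f) -> continuous g ->
  lebesgue_measure.-integrable circle (EFin \o (fun u => f u * g u)).
Proof.
move=> fi cg.
have mT : measurable (circle : set (measurableTypeR R)) by exact: measurable_itv.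
have := @integrableMl _ _ _ lebesgue_measure _ mT (EFin \o f) g fi.
apply.
  by apply: measurable_funTS; exact: continuous_measurable_fun.
have [||c _ cmax] := @EVT_max R (fun u => `|g u|) 0 (2 * pi).
- by rewrite mulr_ge0 // pi_ge0.
- by apply: continuous_subspaceT => u; apply: cvg_norm; exact: cg.
exists `|g c|; split; first exact: num_real.
by move=> M /ltW cM u uT; apply: le_trans cM; apply: cmax.
Qed.

(** The real part of F(u) e^{-i (k u + theta)} for F = f1 + i f2.  Letting theta
    vary replaces taking the modulus of a complex integral. *)
Definition wave {R : realType} (f1 f2 : R -> R) (k : int) (theta u : R) : R :=
  f1 u * cos (k%:~R * u + theta) + f2 u * sin (k%:~R * u + theta).

Lemma wave_integrable {R : realType} (f1 f2 : R -> R) k theta :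
  lebesgue_measure.-integrable circle (EFin \o f1) ->
  lebesgue_measure.-integrable circle (EFin \o f2) ->
  lebesgue_measure.-integrable circle (EFin \o wave f1 f2 k theta).
Proof.
move=> i1 i2.
have mT : measurable (circle : set (measurableTypeR R)) by exact: measurable_itv.
have h1 := circle_integrableM i1 (@continuous_coslin R k%:~R theta).
have h2 := circle_integrableM i2 (@continuous_sinlin R k%:~R theta).
exact: (integrableD mT h1 h2).
Qed.

(** Multiplication by a cosine shifts the frequency by n in both directions;
    its centre s only enters through the phase theta. *)
Lemma wave_mul_cos {R : realType} (f1 f2 : R -> R) k theta (n : nat) (s u : R) :
  wave f1 f2 k theta u * cos (n%:R * (u - s)) =
  2^-1 * (wave f1 f2 (k - n%:Z) (theta + n%:R * s) u +
          wave f1 f2 (k - - n%:Z) (theta - n%:R * s) u).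
Proof.
rewrite /wave !intrB !intrN -!pmulrn.
set A := k%:~R * u + theta; set B := n%:R * (u - s).
have -> : (k%:~R - n%:R) * u + (theta + n%:R * s) = A - B by rewrite /A /B; ring.
have -> : (k%:~R - - n%:R) * u + (theta - n%:R * s) = A + B by rewrite /A /B; ring.
by rewrite (cosB A B) (sinB A B) (cosD A B) (sinD A B); field.
Qed.

(** With A and B the real and imaginary parts of the integral of F e^{-iku}, the
    left-hand side is A cos(theta) + B sin(theta), at most the modulus. *)
Lemma int_wave_le {R : realType} (F : R -> R[i]) k (theta : R) :
  cintegrable circle F ->
  \int[lebesgue_measure]_(u in circle)
     wave (fun t => complex.Re (F t)) (fun t => complex.Im (F t)) k theta u
  <= 2 * pi * ComplexField.Normc.normc (fourier_coef F k).
Proof.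
move=> [i1 i2].
have mT : measurable (circle : set (measurableTypeR R)) by exact: measurable_itv.
pose f1 t := complex.Re (F t); pose f2 t := complex.Im (F t).
set A := \int[lebesgue_measure]_(t in circle)
           complex.Re (F t * expi (- (k%:~R * t))).
set B := \int[lebesgue_measure]_(t in circle)
           complex.Im (F t * expi (- (k%:~R * t))).
have eA t : complex.Re (F t * expi (- (k%:~R * t))) = wave f1 f2 k 0 t.
  rewrite /wave /f1 /f2 /expi; case: (F t) => a b /=.
  by rewrite cosN sinN addr0 mulrN opprK.
have eB t : complex.Im (F t * expi (- (k%:~R * t))) = wave f1 f2 k (pi / 2) t.
  rewrite /wave /f1 /f2 /expi; case: (F t) => a b /=.
  by rewrite cosN sinN cosDpihalf sinDpihalf.
have -> : \int[lebesgue_measure]_(u in circle) wave f1 f2 k theta u =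
    cos theta * A + sin theta * B.
  have iA := wave_integrable k 0 i1 i2.
  have iB := wave_integrable k (pi / 2) i1 i2.
  have -> : A = \int[lebesgue_measure]_(t in circle) wave f1 f2 k 0 t.
    by apply: eq_Rintegral => t _; exact: eA.
  have -> : B = \int[lebesgue_measure]_(t in circle) wave f1 f2 k (pi / 2) t.
    by apply: eq_Rintegral => t _; exact: eB.
  rewrite -!RintegralZl // -RintegralD //.
  - apply: eq_Rintegral => t _.
    by rewrite /wave cosDpihalf sinDpihalf addr0 cosD sinD; ring.
  - exact: (integrableZl mT (cos theta) iA).
  - exact: (integrableZl mT (sin theta) iB).
have -> : fourier_coef F k = Complex (A / (2 * pi)) (B / (2 * pi)).
  by rewrite /fourier_coef /cintegral -/A -/B; simpc; rewrite ![_ ^-1 * _]mulrC.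
have pi0 := pi_gt0 R.
have p2 : 0 < 2 * pi :> R by rewrite mulr_gt0.
rewrite /ComplexField.Normc.normc.
have -> : (A / (2 * pi)) ^+ 2 + (B / (2 * pi)) ^+ 2 = (A ^+ 2 + B ^+ 2) / (2 * pi) ^+ 2.
  by rewrite !expr_div_n -mulrDl.
rewrite sqrtrM ?addr_ge0 ?sqr_ge0 // sqrtrV ?sqr_ge0 // sqrtr_sqr ger0_norm ?(ltW p2) //.
rewrite mulrCA divff ?lt0r_neq0 // mulr1.
apply: le_trans (ler_norm _) _; rewrite -sqrtr_sqr ler_wsqrtr //.
have : 0 <= (sin theta * A - cos theta * B) ^+ 2 by exact: sqr_ge0.
have cs := cos2Dsin2 theta.
have -> : (cos theta * A + sin theta * B) ^+ 2 = 
  (cos theta ^+ 2 + sin theta ^+ 2) * (A ^+ 2 + B ^+ 2) -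
  (sin theta * A - cos theta * B) ^+ 2 by ring.
by rewrite cs mul1r; lra.
Qed.

(** The bound does not see the centre s of the tent, which can therefore be
    chosen as a function of k. *)
Lemma int_wave_tent_sum {R : realType} (f1 f2 : R -> R) (x : int -> R) (h s : R) N k theta :
  lebesgue_measure.-integrable circle (EFin \o f1) ->
  lebesgue_measure.-integrable circle (EFin \o f2) ->
  (forall m th, \int[lebesgue_measure]_(u in circle) wave f1 f2 m th u
     <= 2 * pi * x m) ->
  \int[lebesgue_measure]_(u in circle) (wave f1 f2 k theta u * tent_sum h N (u - s))
  <= 2 * pi * \sum_(j <- tent_spec h N) j.1 * x (k - j.2).
Proof.
move=> i1 i2 wx.
have mT : measurable (circle : set (measurableTypeR R)) by exact: measurable_itv.
have wi m th := wave_integrable m th i1 i2.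
move: (wave f1 f2) wi wx (@wave_mul_cos R f1 f2) => w wi wx wM.
elim: N => [|N IH].
  rewrite big_seq1 /= subr0.
  have -> : \int[lebesgue_measure]_(u in circle) (w k theta u * tent_sum h 0 (u - s)) =
    \int[lebesgue_measure]_(u in circle) (h ^+ 2 / (2 * pi) * w k theta u).
    by apply: eq_Rintegral => u _; rewrite /tent_sum big_ord0 addr0 mulrC.
  rewrite RintegralZl // mulrCA ler_wpM2l //.
  by rewrite divr_ge0 ?sqr_ge0 ?mulr_ge0 ?pi_ge0.
rewrite /= !big_cons /=.
have -> : \int[lebesgue_measure]_(u in circle) (w k theta u * tent_sum h N.+1 (u - s)) =
    \int[lebesgue_measure]_(u in circle) (w k theta u * tent_sum h N (u - s) +
      tent_weight h N.+1 / 2 * (w (k - N.+1%:Z) (theta + N.+1%:R * s) u +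
          w (k - - N.+1%:Z) (theta - N.+1%:R * s) u)).
  apply: eq_Rintegral => u _.
  rewrite tent_sumS mulrDr; congr (_ + _).
  by rewrite mulrCA wM; ring.
have iN := circle_integrableM (wi k theta) (@continuous_tent_sum R h s N).
have iD := integrableD mT (wi (k - N.+1%:Z) (theta + N.+1%:R * s))
   (wi (k - - N.+1%:Z) (theta - N.+1%:R * s)).
rewrite RintegralD //; last exact: (integrableZl mT (tent_weight h N.+1 / 2) iD).
rewrite RintegralZl // RintegralD //.
have t0 : 0 <= tent_weight h N.+1 / 2 by rewrite divr_ge0 ?tent_weight_ge0.
have l1 := ler_wpM2l t0 (wx (k - N.+1%:Z) (theta + N.+1%:R * s)).
have l2 := ler_wpM2l t0 (wx (k - - N.+1%:Z) (theta - N.+1%:R * s)).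
rewrite (mulrDr (tent_weight h N.+1 / 2)).
apply: (le_trans (lerD IH (lerD l1 l2))).
by rewrite le_eqVlt; apply/orP; left; apply/eqP; ring.
Qed.

Lemma ae_impl {R : realType} (P Q : R -> Prop) : (forall x, P x -> Q x) ->
  {ae lebesgue_measure, forall x : R, P x} ->
  {ae lebesgue_measure, forall x : R, Q x}.
Proof.
move=> PQ [N [mN N0 PN]]; exists N; split => // x /= nQ.
by apply: PN => /= Px; apply: nQ; exact: PQ.
Qed.

(** The tent is at least h/2 on the inner half of its support, an interval of
    length h, and the integrand is nonnegative elsewhere. *)
Lemma int_tent_ge {R : realType} (w : R -> R) (h s : R) :
  lebesgue_measure.-integrable circle (EFin \o w) ->
  0 < h -> h <= s -> s <= 2 * pi - h ->
  {ae lebesgue_measure, forall u : R, `|u - s| <= h -> 2^-1 <= w u} ->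
  h ^+ 2 / 4 <= \int[lebesgue_measure]_(u in circle) (w u * tent h (u - s)).
Proof.
move=> wi h0 hs sh wge.
have mT : measurable (circle : set (measurableTypeR R)) by exact: measurable_itv.
have iG := circle_integrableM wi (@continuous_tent R h s).
set G := fun u => w u * tent h (u - s).
pose E : set (measurableTypeR R) := `[s - h / 2, s + h / 2]%classic.
have mE : measurable E by exact: measurable_itv.
have mG : measurable_fun (circle : set (measurableTypeR R)) G.
  by apply/measurable_EFinP; exact: (measurable_int _ iG).
have mGp : measurable_fun (circle : set (measurableTypeR R)) (fun u => Num.max (G u) 0).
  by apply: measurable_maxr => //; exact: measurable_cst.
have Gge0 : {ae lebesgue_measure, forall u : R, 0 <= G u}.
  apply: ae_impl wge => u wu; rewrite /G /tent.
  have [us|us] := leP `|u - s| h.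
    by rewrite mulr_ge0 // ?le_max ?lexx ?orbT // (le_trans _ (wu us)).
  by rewrite max_r ?mulr0 // subr_le0 ltW.
suff : ((h ^+ 2 / 4)%:E <= \int[lebesgue_measure]_(u in circle) (G u)%:E)%E.
  by move=> H; rewrite -lee_fin /Rintegral fineK //; exact: integrable_fin_num.
(* G is nonnegative only almost everywhere; its positive part has the same
   integral. *)
have -> : (\int[lebesgue_measure]_(u in circle) (G u)%:E =
   \int[lebesgue_measure]_(u in circle) (Num.max (G u) 0)%:E)%E.
  apply: ae_eq_integral => //; [exact/measurable_EFinP|exact/measurable_EFinP|].
  by apply: ae_impl Gge0 => u Gu _; rewrite max_l.
have -> : ((h ^+ 2 / 4)%:E = \int[lebesgue_measure]_(u in circle) (h / 4 * \1_E u)%:E)%E.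
  under eq_integral do rewrite EFinM.
  rewrite ge0_integralZl_EFin //; first last.
  - by rewrite divr_ge0 // ltW.
  - by apply/measurable_EFinP; apply: measurable_indic.
  rewrite integral_indic // setIidl; last first.
    by move=> u; rewrite /E /= !in_itv /= => /andP[u1 u2]; apply/andP; split; lra.
  have muE : lebesgue_measure E = h%:E.
    rewrite /E lebesgue_measure_itv /= lte_fin ifT; last by lra.
    by rewrite -EFinB; congr EFin; field.
  by rewrite -[X in (_ * X)%E]/(lebesgue_measure E) muE -EFinM; congr EFin; field.
apply: ae_ge0_le_integral => //.
- by move=> u _; rewrite lee_fin mulr_ge0 // divr_ge0 // ltW.
- apply/measurable_EFinP; apply: measurable_funM => //.
- by move=> u _; rewrite lee_fin le_max lexx orbT.
- exact/measurable_EFinP.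
apply: ae_impl wge => u wu _; rewrite lee_fin le_max indicE.
have [|] := boolP (u \in E); last by rewrite mulr0 lexx orbT.
rewrite inE /E /= in_itv /= => /andP[u1 u2].
have us : `|u - s| <= h / 2 by rewrite ler_norml; lra.
have wu' : 2^-1 <= w u by apply: wu; lra.
rewrite mulr1 /G /tent max_l; last by lra.
apply/orP; left; apply: (@le_trans _ _ (2^-1 * (h / 2))); first by lra.
by apply: ler_pM => //; [lra|lra].
Qed.

(** A single finite spectrum r serves all frequencies, phases and centres: the
    error made in replacing the tent by a trigonometric polynomial is at most the
    L^1 norm of |f1| + |f2| times the uniform distance, which does not depend on
    them.  It takes up half of the lower bound h^2/4 of int_tent_ge. *)
Lemma local_frequency {R : realType} (f1 f2 : R -> R) (x : int -> R) (h : R) :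
  lebesgue_measure.-integrable circle (EFin \o f1) ->
  lebesgue_measure.-integrable circle (EFin \o f2) ->
  (forall m th, \int[lebesgue_measure]_(u in circle) wave f1 f2 m th u
     <= 2 * pi * x m) ->
  0 < h -> h <= 2 * pi ->
  exists2 r : seq (R * int),
    (forall j, j \in r -> 0 <= j.1) /\ \sum_(j <- r) j.1 <= 2 * h &
    forall k theta s, h <= s -> s <= 2 * pi - h ->
      {ae lebesgue_measure, forall u : R, `|u - s| <= h -> 2^-1 <= wave f1 f2 k theta u} ->
      h ^+ 2 / (16 * pi) <= \sum_(j <- r) j.1 * x (k - j.2).
Proof.
move=> i1 i2 wx h0 hpi.
have pi0 := pi_gt0 R.
have mT : measurable (circle : set (measurableTypeR R)) by exact: measurable_itv.
have i1n : lebesgue_measure.-integrable circle (EFin \o (fun u => `|f1 u|)).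
  exact: (integrable_norm i1).
have i2n : lebesgue_measure.-integrable circle (EFin \o (fun u => `|f2 u|)).
  exact: (integrable_norm i2).
have iL : lebesgue_measure.-integrable circle (EFin \o (fun u => `|f1 u| + `|f2 u|)).
  exact: (integrableD mT i1n i2n).
set L := \int[lebesgue_measure]_(u in circle) (`|f1 u| + `|f2 u|).
have L0 : 0 <= L by apply: Rintegral_ge0 => u _; rewrite addr_ge0.
(* The two terms of M make the approximation error at most h, for the mass of
   the spectrum, and L times it at most h^2 / 8, for the integral. *)
pose M := 8 / pi / h + L * (8 / pi) / (h ^+ 2 / 8).
pose N := Num.truncn M.
have MN : M <= N.+1%:R by rewrite ltW // truncnS_gt.
have M1 : 0 <= 8 / pi / h by rewrite divr_ge0 ?divr_ge0 // ltW.
have M2 : 0 <= L * (8 / pi) / (h ^+ 2 / 8).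
  have h8 : 0 <= h ^+ 2 / 8 by rewrite divr_ge0 ?sqr_ge0.
  by rewrite divr_ge0 // mulr_ge0 // divr_ge0 // ltW.
have N0 : 0 < N.+1%:R :> R by rewrite ltr0n.
have Nh : 8 / pi / N.+1%:R <= h.
  by rewrite ler_pdivrMr // (mulrC h) -ler_pdivrMr //; apply: le_trans MN; rewrite lerDl.
have NL : L * (8 / pi / N.+1%:R) <= h ^+ 2 / 8.
  rewrite mulrA ler_pdivrMr // (mulrC (h ^+ 2 / 8)) -ler_pdivrMr ?divr_gt0 ?exprn_gt0 //.
  by apply: le_trans MN; rewrite lerDr.
exists (tent_spec h N.+1).
  by split; [exact: tent_spec_ge0|exact: tent_spec_mass].
move=> k theta s hs sh wge.
have iw := wave_integrable k theta i1 i2.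
have lo := int_tent_ge iw h0 hs sh wge.
have up := int_wave_tent_sum h s N.+1 k theta i1 i2 wx.
have iT := circle_integrableM iw (@continuous_tent R h s).
have iS := circle_integrableM iw (@continuous_tent_sum R h s N.+1).
set e := 8 / pi / N.+1%:R in Nh NL.
have : \int[lebesgue_measure]_(u in circle) (wave f1 f2 k theta u * tent h (u - s)) <=
  \int[lebesgue_measure]_(u in circle) (wave f1 f2 k theta u * tent_sum h N.+1 (u - s) +
     e * (`|f1 u| + `|f2 u|)).
  apply: le_Rintegral => //.
    exact: (integrableD mT iS (integrableZl mT e iL)).
  move=> u; rewrite /= in_itv /= => /andP[u0 u2].
  have ts : `|tent_sum h N.+1 (u - s) - tent h (u - s)| <= e.
    by apply: tent_approx => //; rewrite ler_norml; apply/andP; split; lra.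
  rewrite -lerBlDl -mulrBr; apply: le_trans (ler_norm _) _.
  rewrite normrM mulrC distrC ler_pM //.
  apply: le_trans (ler_normD _ _) _; rewrite !normrM.
  by apply: lerD; rewrite ler_piMr // ?cos_max ?sin_max.
rewrite RintegralD //; last exact: (integrableZl mT e iL).
rewrite RintegralZl // -/L => H.
rewrite -(ler_pM2l (_ : 0 < 2 * pi)); last by rewrite mulr_gt0.
apply: le_trans up.
have -> : 2 * pi * (h ^+ 2 / (16 * pi)) = h ^+ 2 / 8.
  by move: (lt0r_neq0 pi0); move: (@pi R) => q q0; field.
move: (le_trans lo H) NL; rewrite (mulrC L).
move: (Rintegral _ _ _) => A; move: (e * L) => B; clear; lra.
Qed.

(** * Lower bounds for the norm of the coefficients *)

(** If every k in K has a window on which F resonates with e^{iku}, then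
    discrete_young applies to the coefficients of F with D = 2h and
    eta = h^2 / (16 pi). *)
Lemma Ap_norm_ge {R : realType} (p h : R) (F : R -> R[i]) (K : seq int) :
  1 <= p -> cintegrable circle F -> 0 < h -> h <= 2 * pi -> uniq K ->
  (forall k, k \in K -> exists theta s, [/\ h <= s, s <= 2 * pi - h &
     {ae lebesgue_measure, forall u : R, `|u - s| <= h ->
        2^-1 <= wave (fun t => complex.Re (F t)) (fun t => complex.Im (F t)) k theta u}]) ->
  (((size K)%:R `^ p^-1 * (h / (32 * pi)))%:E <= Ap_norm p F)%E.
Proof.
move=> p1 Fi h0 hpi uK hK; have [i1 i2] := Fi.
have p0 : 0 < p by apply: lt_le_trans p1.
pose x k := ComplexField.Normc.normc (fourier_coef F k).
have x0 k : 0 <= x k.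
  by rewrite /x; case: (fourier_coef F k) => a b; exact: sqrtr_ge0.
have wx m th := @int_wave_le R F m th Fi.
have [r [r0 rD] rK] := local_frequency i1 i2 wx h0 hpi.
have pi0 := pi_gt0 R.
rewrite /Ap_norm.
set S := (\esum_(k in _) _)%E.
have S0 : (0 <= S)%E by apply: esum_ge0 => k _; rewrite lee_fin powR_ge0.
have hS m : ((\sum_(k <- K) x (k - m) `^ p)%:E <= S)%E.
  rewrite -sumEFin -(big_map (fun k => k - m) xpredT (fun k => (x k `^ p)%:E)).
  apply: esum_ge; exists [set` [seq k - m | k <- K]].
    by split => //; exact: finite_seq.
  by rewrite fsbig_seq ?map_inj_uniq // => a b /addIr.
have [->|Sfin] := eqVneq S +oo%E.
  by rewrite poweRyr ?leey // invr_eq0 lt0r_neq0.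
have Sf : S \is a fin_num by rewrite ge0_fin_numE // lt_neqAle Sfin leey.
rewrite -(fineK Sf) poweR_EFin lee_fin.
have : (size K)%:R * (h / (32 * pi)) `^ p <= fine S.
  have -> : h / (32 * pi) = h ^+ 2 / (16 * pi) / (2 * h).
    move: (lt0r_neq0 pi0); move: (@pi R) => q q0; field.
    by rewrite q0 lt0r_neq0.
  apply: (@discrete_young R p r x K (2 * h) _ (fine S)) => //.
  - by rewrite mulr_gt0.
  - by rewrite divr_gt0 ?exprn_gt0 // mulr_gt0.
  - by move=> k /hK[theta [s [s1 s2 wge]]]; exact: rK wge.
  - by move=> m; rewrite -lee_fin fineK.
have y0 : 0 <= h / (32 * pi) by rewrite divr_ge0 ?mulr_ge0 // ltW.
move=> H; have pV : 0 <= p^-1 by rewrite invr_ge0 ltW.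
have := ge0_ler_powR pV _ _ H.
rewrite !nnegrE mulr_ge0 ?powR_ge0 // fine_ge0 // => /(_ isT isT).
rewrite powRM ?powR_ge0 // -powRrM divff ?lt0r_neq0 // powRr1 //.
Qed.

(** * Calculus on an interval *)

Lemma sin_norm_le {R : realType} (x : R) : `|sin x| <= `|x|.
Proof.
wlog x0 : x / 0 <= x.
  move=> H; have [|/ltW x0] := leP 0 x; first exact: H.
  by rewrite -normrN -sinN -[leRHS]normrN; apply: H; rewrite oppr_ge0.
have [|c _] := @MVT_segment R sin cos 0 x x0.
  by apply: continuous_subspaceT => y; exact: continuous_sin.
rewrite sin0 !subr0 => ->.
by rewrite normrM ler_piMl // cos_max.
Qed.

Lemma cos_ge_half {R : realType} (x : R) : `|x| <= 1 -> 2^-1 <= cos x.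
Proof.
move=> x1.
have -> : cos x = 1 - 2 * sin (x / 2) ^+ 2.
  have {1}-> : x = (x / 2) *+ 2 by rewrite -mulr_natr divfK.
  by rewrite cos_mulr2n cos2sin2; ring.
have : sin (x / 2) ^+ 2 <= 4^-1.
  rewrite -[leLHS]ger0_norm ?sqr_ge0 // normrX.
  have -> : 4^-1 = 2^-1 ^+ 2 :> R by field.
  rewrite lerXn2r ?nnegrE //.
  apply: le_trans (sin_norm_le _) _; rewrite normrM normfV (ger0_norm (x := 2)) //.
  by rewrite ler_piMl.
lra.
Qed.

(** Unlike the difference quotient, this form of the derivative makes sense for
    s = t. *)
Lemma derivative_on_slope {R : realType} (I : set R) (g dg : R -> R) :
  is_derivative_on I g dg -> forall t e, I t -> 0 < e ->
  exists2 d, 0 < d & forall s, I s -> `|s - t| < d ->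
    `|g s - g t - dg t * (s - t)| <= e * `|s - t|.
Proof.
move=> hg t e It e0.
have /cvgrPdist_lt/(_ e e0) := hg t It.
rewrite near_withinE /dnbhs near_withinE => /nbhs_ballP[d /= d0 hd].
exists d => // s Is st.
have [->|sNt] := eqVneq s t; first by rewrite !subrr mulr0 subr0 normr0 mulr0.
have bs : ball t d s by rewrite -ball_normE /= distrC.
have := hd s bs sNt Is; rewrite distrC => /ltW.
have s0 : s - t != 0 by rewrite subr_eq0.
rewrite -(ler_pM2r (_ : 0 < `|s - t|)) ?normr_gt0 // -normrM mulrBl divfK //.
Qed.

Lemma near_dist_lt {R : realType} (x d : R) : 0 < d -> \forall z \near x, `|z - x| < d.
Proof.
move=> d0; apply/nbhs_ballP; exists d => // z.
by rewrite -ball_normE /= distrC.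
Qed.

(** The derivative on I is two-sided only in the interior of the segment from a
    to b; at its end points continuity relative to I is enough. *)
Lemma MVT_on {R : realType} (I : interval R) (g dg : R -> R) (a b : R) :
  is_derivative_on [set` I] g dg -> a \in I -> b \in I -> a <= b ->
  exists2 c, a <= c <= b & g b - g a = dg c * (b - a).
Proof.
move=> hg aI bI ab.
have sub x : a <= x -> x <= b -> [set` I] x.
  by move=> ax xb; have := @interval_is_interval _ I a b aI bI; apply; rewrite ax xb.
have [|| c + E] := @MVT_segment R g dg a b ab.
- move=> x; rewrite in_itv /= => /andP[ax xb].
  have Ix : [set` I] x by apply: sub; exact: ltW.
  apply/is_derive1_caratheodory.
  pose q z := if z == x then dg x else (g z - g x) / (z - x).
  exists q; split; last by rewrite /q eqxx.
    move=> z; rewrite /q; case: eqP => [->|/eqP zx]; first by rewrite !subrr mulr0.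
    by rewrite divfK // subr_eq0.
  apply/cvgrPdist_le => e e0.
  have [d d0 hd] := derivative_on_slope hg Ix e0.
  near=> z.
  have az : a < z by near: z; exact: lt_nbhsr.
  have zb : z < b by near: z; exact: lt_nbhsl.
  have zd : `|z - x| < d.
    by near: z; exact: near_dist_lt.
  rewrite /q eqxx; case: eqP => [_|/eqP zx]; first by rewrite subrr normr0 ltW.
  have zx0 : z - x != 0 by rewrite subr_eq0.
  rewrite -(ler_pM2r (_ : 0 < `|z - x|)) ?normr_gt0 // -normrM mulrBl divfK //.
  by rewrite distrC; apply: hd => //; apply: sub; exact: ltW.
- apply/subspace_continuousP => x; rewrite /= in_itv /= => /andP[ax xb].
  have Ix : [set` I] x by apply: sub.
  have [d d0 hd] := derivative_on_slope hg Ix ltr01.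
  apply/cvgrPdist_le => e e0; rewrite near_withinE.
  pose M := `|dg x| + 1.
  have M0 : 0 < M by rewrite ltr_wpDl.
  near=> z => /=; rewrite in_itv /= => /andP[az zb].
  have zd : `|z - x| < d.
    by near: z; exact: near_dist_lt.
  have ze : `|z - x| < e / M.
    by near: z; apply: near_dist_lt; rewrite divr_gt0.
  have := hd z (sub _ az zb) zd.
  rewrite mul1r => h1.
  have h2 : `|dg x * (z - x)| = `|dg x| * `|z - x| by exact: normrM.
  have h3 : M * `|z - x| <= e by rewrite mulrC -ler_pdivlMr // ltW.
  rewrite distrC; have := ler_normD (g z - g x - dg x * (z - x)) (dg x * (z - x)).
  rewrite subrK h2 => /le_trans; apply; apply: le_trans h3.
  by rewrite /M mulrDl mul1r addrC lerD2l.
by rewrite in_itv /= => acb; exists c.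
Unshelve. all: by end_near. Qed.

Lemma Lip_omegaP {R : realType} (omega : R -> R) (I : set R) (g : R -> R) :
  Lip_omega omega I g -> exists C d : R, 0 < d /\
    forall e t1 t2, 0 < e -> e < d -> I t1 -> I t2 -> `|t1 - t2| <= e ->
      `|g t1 - g t2| <= C * omega e.
Proof.
move=> [C]; rewrite /at_right near_withinE => /nbhs_ballP[d /= d0 hd].
exists C, d; split=> // e t1 t2 e0 ed I1 I2 t12.
have be : ball 0 d e by rewrite -ball_normE /= sub0r normrN gtr0_norm.
have := hd e be e0; rewrite -lee_fin; apply: le_trans.
by apply: ereal_sup_ubound; exists t1, t2.
Qed.

(** * The modulus of continuity and the inverse of chi *)

Lemma interval_between {R : realType} (I : interval R) (a b x : R) :
  a \in I -> b \in I -> a <= x -> x <= b -> x \in I.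
Proof.
by move=> aI bI ax xb; apply: (@interval_is_interval _ I a b aI bI); rewrite ax xb.
Qed.

(** If omega vanished at a positive number, g would be constant on short
    segments, hence on I. *)
Lemma Lip_omega_gt0 {R : realType} (omega : R -> R) (I : interval R) (g : R -> R) (a b : R) :
  (forall x y : R, 0 <= x -> x <= y -> omega x <= omega y) -> omega 0 = 0 ->
  Lip_omega omega [set` I] g -> a \in I -> b \in I -> g a != g b ->
  forall x, 0 < x -> 0 < omega x.
Proof.
move=> mono om0 /Lip_omegaP[C [d [d0 hC]]] aI bI gab x x0.
rewrite ltNge; apply/negP => omx.
pose e := Num.min x (d / 2).
have e0 : 0 < e by rewrite lt_min x0 divr_gt0.
have ed : e < d by rewrite gt_min ltr_pdivrMr // ltr_pMr // ltr1n orbT.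
have ome : omega e = 0.
  apply/eqP; rewrite eq_le -{2}om0 mono ?lexx ?(ltW e0) // andbT.
  by apply: le_trans omx; rewrite mono ?ge_min ?lexx // ltW.
have step t1 t2 : t1 \in I -> t2 \in I -> `|t1 - t2| <= e -> g t1 = g t2.
  move=> I1 I2 t12; have := hC e t1 t2 e0 ed I1 I2 t12.
  by rewrite ome mulr0 normr_le0 subr_eq0 => /eqP.
have chain n : forall t1 t2, t1 \in I -> t2 \in I -> t1 <= t2 ->
    t2 - t1 <= n%:R * e -> g t1 = g t2.
  elim: n => [|n IH] t1 t2 I1 I2 t12.
    rewrite mul0r subr_le0 => t21; congr g.
    by apply/eqP; rewrite eq_le t12 t21.
  rewrite -natr1 mulrDl mul1r => tn.
  have [t2e|et2] := leP (t2 - t1) e.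
    by apply: step => //; rewrite distrC ger0_norm // subr_ge0.
  have I3 : t1 + e \in I.
    by apply: (interval_between I1 I2); [rewrite lerDl ltW|lra].
  rewrite (step t1 (t1 + e)) //; last by rewrite opprD addNKr normrN gtr0_norm.
  by apply: IH => //; lra.
move: gab; apply/negP; rewrite negbK; apply/eqP.
wlog ab : a b aI bI / a <= b.
  move=> H; have [|/ltW ba] := leP a b; first exact: H.
  by apply/esym; apply: H.
apply: (chain (Num.truncn ((b - a) / e)).+1) => //.
by rewrite -ler_pdivrMr // ltW // truncnS_gt.
Qed.

(** At the upper bound in the statement chi is at least 1, so all values y <= 1
    are attained below it. *)
Lemma chi_invP {R : realType} (omega : R -> R) (y : R) :
  {within [set x : R | 0 <= x], continuous omega} ->
  (forall x y : R, 0 <= x -> x <= y -> omega x <= omega y) ->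
  (forall x, 0 < x -> 0 < omega x) -> 0 < y -> y <= 1 ->
  [/\ 0 < chi_inv omega y, chi_inv omega y <= Num.max 1 (omega 1)^-1
    & chi_inv omega y * omega (chi_inv omega y) = y].
Proof.
move=> comega mono pos y0 y1.
set M := Num.max 1 _.
have o1 : 0 < omega 1 by apply: pos.
have M1 : 1 <= M by rewrite le_max lexx.
have M0 : 0 <= M by apply: le_trans M1.
have cchi : {within `[0, M], continuous (chi omega)}.
  have c1 : {within `[0, M], continuous omega}.
    by apply: continuous_subspaceW comega => z /=; rewrite in_itv /= => /andP[].
  move=> z; apply: cvgM; last exact: c1.
  by apply: continuous_subspaceT => u; exact: cvg_id.
have chiM : 1 <= chi omega M.
  apply: (@le_trans _ _ ((omega 1)^-1 * omega 1)).
    by rewrite mulVf // lt0r_neq0.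
  apply: ler_pM; rewrite ?invr_ge0 ?(ltW o1) //.
    by rewrite le_max lexx orbT.
  by apply: mono.
have ychi : y \in chi omega @` [set x | 0 <= x].
  have chi0 : chi omega 0 = 0 by rewrite /chi mul0r.
  have [|c] := IVT M0 cchi (v := y).
    rewrite chi0 ge_min le_max (ltW y0) /=; apply/orP; right.
    exact: le_trans chiM.
  rewrite in_itv /= => /andP[c0 _] cy.
  by rewrite inE; exists c.
have chiE := pinvK (fun=> 0) ychi; rewrite -/(chi_inv omega) in chiE.
have inv0 : 0 <= chi_inv omega y.
  have sur : set_surj [set x : R | 0 <= x] (chi omega @` [set x | 0 <= x]) (chi omega).
    by [].
  apply: (surjpinv_image_sub (dflt := fun=> 0) sur).
  by exists y => //; exact: set_mem.
have invE : chi_inv omega y * omega (chi_inv omega y) = y by exact: chiE.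
have inv_gt0 : 0 < chi_inv omega y.
  rewrite lt_neqAle inv0 andbT; apply/eqP => E.
  by move: y0; rewrite -invE -E mul0r ltxx.
split => //.
rewrite le_max; have [//|lt1] := leP (chi_inv omega y) 1.
rewrite orFb -[leRHS]mul1r ler_pdivlMr //; apply: le_trans y1.
rewrite -[leRHS]invE; rewrite ler_pM2l //.
by apply: mono => //; exact: ltW.
Qed.

(** * Slopes and frequencies *)

Lemma nonlinear_slopes {R : realType} (I : interval R) (g dg : R -> R) :
  is_derivative_on [set` I] g dg -> ~ linear_on [set` I] g ->
  exists a b, [/\ a \in I, b \in I, a < b & dg a != dg b].
Proof.
move=> hg nlin; apply: contrapT => hN; apply: nlin.
have [[t0 It0]|I0] := pselect (exists t, t \in I); last first.
  by exists 0, 0 => t It; exfalso; apply: I0; exists t.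
have const t : t \in I -> dg t = dg t0.
  move=> It; apply: contrapT => /eqP tt0; apply: hN.
  have [lt|lt|E] := ltgtP t t0; last by rewrite E eqxx in tt0.
    by exists t, t0; split.
  by exists t0, t; split => //; rewrite eq_sym.
exists (dg t0), (g t0 - dg t0 * t0) => t It.
have [tt0|/ltW tt0] := leP t0 t.
  have [c /andP[c1 c2] E] := MVT_on hg It0 It tt0.
  move: E; rewrite const; last exact: interval_between c1 c2.
  by rewrite mulrBr => E; rewrite addrCA -E addrC subrK.
have [c /andP[c1 c2] E] := MVT_on hg It It0 tt0.
move: E; rewrite const; last exact: interval_between c1 c2.
by rewrite mulrBr => E; apply/eqP; rewrite addrCA -subr_eq0 opprD addrA;
  apply/eqP; move: E; lra.
Qed.

Lemma interval_short {R : realType} (I : interval R) (a b l : R) :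
  (lebesgue_measure [set` I] < l%:E)%E -> a \in I -> b \in I -> a < b -> b - a < l.
Proof.
move=> hI aI bI ab; rewrite -lte_fin; apply: le_lt_trans hI.
have -> : (b - a)%:E = lebesgue_measure (`[a, b]%classic : set R).
  by rewrite lebesgue_measure_itv /= lte_fin ab EFinB.
apply: le_measure; rewrite ?inE //.
by move=> x; rewrite /= in_itv /= => /andP[ax xb]; exact: interval_between ax xb.
Qed.

(** I contains at most one multiple of 2 pi strictly between a and b.  If it does
    contain one, the slope there differs from the slope at a or from the slope
    at b. *)
Lemma slopes_in_period {R : realType} (I : interval R) (dg : R -> R) (a b : R) :
  (lebesgue_measure [set` I] < (2 * pi)%:E)%E ->
  a \in I -> b \in I -> a < b -> dg a != dg b ->
  exists (n : int) (a' b' : R), [/\ a' \in I, b' \in I, a' < b', dg a' != dg b' &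
    2 * pi * n%:~R <= a' /\ b' <= 2 * pi * n%:~R + 2 * pi].
Proof.
move=> hI aI bI ab dab; have ba := interval_short hI aI bI ab.
have pi2 : 0 < 2 * pi :> R by rewrite mulr_gt0 // pi_gt0.
pose n := Num.floor (a / (2 * pi)).
have /andP[n1 n2] := floor_itv (a / (2 * pi)).
rewrite -/n in n1 n2.
have na : 2 * pi * n%:~R <= a by rewrite mulrC -ler_pdivlMr.
have an : a < 2 * pi * n%:~R + 2 * pi.
  by move: n2; rewrite ltr_pdivrMr // intrD mulrDl mul1r mulrC.
have [bn|nb] := leP b (2 * pi * n%:~R + 2 * pi).
  by exists n, a, b.
set c := 2 * pi * n%:~R + 2 * pi in an nb *.
have cI : c \in I by apply: (interval_between aI bI); exact: ltW.
have [E|ac] := eqVneq (dg a) (dg c); last first.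
  by exists n, a, c; split.
exists (n + 1), c, b; split => //; first by rewrite -E.
rewrite intrD mulrDr mulr1 -/c; split => //.
by move: ba an; rewrite /c; lra.
Qed.

(** Allowing distance 1 makes the count at least L even when L < 1, that is
    when the interval may contain no integer at all. *)
Lemma integer_frequencies {R : realType} (lo L : R) : 0 <= L ->
  exists K : seq int, [/\ uniq K, L <= (size K)%:R &
    forall k, k \in K -> exists2 v : R, lo <= v <= lo + L & `|k%:~R - v| <= 1].
Proof.
move=> L0; pose m := Num.floor lo.
have /andP[m1 m2] := floor_itv lo; rewrite -/m intrD in m1 m2.
pose n := Num.truncn L.
have /andP[n1 n2] := truncn_itv L0; rewrite -/n in n1 n2.
(* Starting at m + 1 > lo, the last element m + 1 + n is at most lo + L + 1. *)
exists [seq m + 1 + i%:Z | i <- iota 0 n.+1]; split.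
- by rewrite map_inj_uniq ?iota_uniq // => i j /addrI [].
- by rewrite size_map size_iota ltW.
move=> k kK.
have [i + ->] := elimT (@seq.mapP _ _ (fun i : nat => m + 1 + i%:Z) (iota 0 n.+1) k) kK.
rewrite mem_iota add0n ltnS => /andP[_ iN].
have iL : i%:R <= L by apply: le_trans n1; rewrite ler_nat.
have i0 : 0 <= i%:R :> R by [].
rewrite !intrD -pmulrn.
have [h|h] := leP lo (m%:~R + i%:R).
  exists (m%:~R + i%:R); first by rewrite h /=; lra.
  by rewrite ler_norml; lra.
exists lo; first by rewrite lexx lerDl.
by rewrite ler_norml; lra.
Qed.

Lemma Lip_omega_continuous {R : realType} (omega : R -> R) (I : interval R) (g : R -> R) (a b : R) :
  {within [set x : R | 0 <= x], continuous omega} -> omega 0 = 0 ->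
  Lip_omega omega [set` I] g -> a \in I -> b \in I ->
  {within `[a, b], continuous g}.
Proof.
move=> /subspace_continuousP/(_ 0 (lexx 0)) /cvgrPdist_lt oc om0.
move=> /Lip_omegaP[C [d [d0 hC]]] aI bI.
apply/subspace_continuousP => x; rewrite /= in_itv /= => /andP[ax xb].
have Ix := interval_between aI bI ax xb.
apply/cvgrPdist_le => e e0; rewrite near_withinE.
pose M := `|C| + 1.
have M0 : 0 < M by rewrite ltr_wpDl.
have := oc (e / M) (divr_gt0 e0 M0); rewrite near_withinE => /nbhs_ballP[r /= r0 hr].
pose s := Num.min (r / 2) (d / 2).
have s0 : 0 < s by rewrite lt_min !divr_gt0.
have sr : s < r by rewrite gt_min ltr_pdivrMr // ltr_pMr // ltr1n.
have sd : s < d by rewrite gt_min [X in _ || X]ltr_pdivrMr // ltr_pMr // ltr1n orbT.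
have bs : ball 0 r s by rewrite -ball_normE /= sub0r normrN gtr0_norm.
have : `|omega 0 - omega s| < e / M by exact: (hr s bs (ltW s0)).
rewrite om0 sub0r normrN => os.
near=> z => /=; rewrite in_itv /= => /andP[az zb].
have zs : `|z - x| < s by near: z; exact: near_dist_lt.
have Iz := interval_between aI bI az zb.
have := hC s x z s0 sd Ix Iz; rewrite distrC (ltW zs) => /(_ isT) /le_trans; apply.
apply: le_trans (ler_norm _) _; rewrite normrM.
apply: (@le_trans _ _ (M * (e / M))); last by rewrite mulrC divfK ?lt0r_neq0.
by apply: ler_pM => //; [rewrite lerDl|exact: ltW].
Unshelve. all: by end_near. Qed.

(** * Windows of resonance *)

(** Lebesgue measure agrees on intervals with its push-forward by a
    translation. *)
Lemma ae_shift {R : realType} (c : R) (P : R -> Prop) :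
  {ae lebesgue_measure, forall x : R, P x} ->
  {ae lebesgue_measure, forall x : R, P (x + c)}.
Proof.
move=> [N [mN N0 PN]].
pose f : measurableTypeR R -> measurableTypeR R := fun x => x + c.
have cf : continuous (fun x : R => x + c).
  by move=> x; apply: cvgD; [exact: cvg_id|exact: cvg_cst].
have mf : measurable_fun setT f by exact: continuous_measurable_fun.
have mu_f (A : set (measurableTypeR R)) : measurable A ->
    lebesgue_measure A = pushforward lebesgue_measure f A.
  move=> mA; apply: lebesgue_measure_unique => //= _ [[a b]] _ <-.
  rewrite /pushforward.
  have -> : f @^-1` `]a, b]%classic = `]a - c, b - c]%classic.
    by apply/seteqP; split => x; rewrite /f /= !in_itv /= ltrBlDr lerBrDr.
  rewrite !lebesgue_measure_itv /= !lte_fin ltrD2r.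
  case: ifP => // _; congr EFin; ring.
exists (f @^-1` N); split.
- by rewrite -[X in measurable X]setTI; exact: mf.
- by rewrite -[LHS]/(pushforward lebesgue_measure f N) -mu_f.
- by move=> x /= nP; apply: PN.
Qed.

Lemma periodic_int {R : realType} (F : R -> R[i]) (T : R) (n : int) u :
  periodic F T -> F (u + T * n%:~R) = F u.
Proof.
move=> FT; have FTn m v : F (v + T * m%:R) = F v by rewrite mulr_natr periodicn.
case: n => m; first exact: FTn.
by rewrite NegzE intrN mulrN -[LHS](FTn m.+1) subrK.
Qed.

Lemma Ap_integrable {R : realType} (p : R) (F : R -> R[i]) :
  Ap p F -> cintegrable circle F.
Proof.
case=> _ + _; case: ifP => // _ [c1 c2].
by split; apply: continuous_compact_integrable;
  [exact: segment_compact|exact: continuous_subspaceT|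
   exact: segment_compact|exact: continuous_subspaceT].
Qed.

Lemma restricts_to_ae {R : realType} (p : R) (I : set R) (F f : R -> R[i]) :
  restricts_to p I F f -> {ae lebesgue_measure, forall t : R, I t -> F t = f t}.
Proof.
rewrite /restricts_to; case: ifP => // _ H.
by apply: aeW => t It; apply: H; rewrite inE.
Qed.

(** Near an end point of the segment the window is moved inwards, so it is
    centred at s rather than at t. *)
Lemma center_in_segment {R : realType} (a b h t : R) : 0 <= h -> 2 * h <= b - a ->
  a <= t -> t <= b -> exists s, [/\ a + h <= s, s <= b - h & `|s - t| <= h].
Proof.
move=> h0 hab ta tb.
have [h1|h1] := leP t (a + h).
  exists (a + h); split; [by []|lra|rewrite ler_norml; lra].
have [h2|h2] := leP (b - h) t.
  exists (b - h); split; [lra|by []|rewrite ler_norml; lra].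
exists t; split; [lra|lra|].
by rewrite subrr normr0.
Qed.

(** By periodicity the window is brought back into the fundamental period; the
    constant theta is the phase lambda phi(u) - k u at the point t, after this
    translation.  Where the phase moves by at most 1 its cosine is at least 1/2. *)
Lemma resonant_window {R : realType} (I : interval R) (phi : R -> R) (F : R -> R[i])
    (lambda a b t h : R) (k n : int) :
  periodic F (2 * pi) ->
  {ae lebesgue_measure, forall u : R, [set` I] u -> F u = expi (lambda * phi u)} ->
  a \in I -> b \in I -> 2 * pi * n%:~R <= a -> b <= 2 * pi * n%:~R + 2 * pi ->
  a <= t -> t <= b -> 0 < h -> 2 * h <= b - a ->
  (forall u, a <= u -> u <= b -> `|u - t| <= 2 * h ->
     `|lambda * phi u - lambda * phi t - k%:~R * (u - t)| <= 1) ->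
  exists theta s, [/\ h <= s, s <= 2 * pi - h &
    {ae lebesgue_measure, forall u : R, `|u - s| <= h ->
      2^-1 <= wave (fun t => complex.Re (F t)) (fun t => complex.Im (F t)) k theta u}].
Proof.
move=> FT FI aI bI; set tau := 2 * pi * n%:~R => ta tb at_ tb_ h0 hab ph.
have [s [s1 s2 st]] := center_in_segment (ltW h0) hab at_ tb_.
exists (lambda * phi t + k%:~R * (tau - t)), (s - tau); split; [lra|lra|].
apply: ae_impl (ae_shift tau FI) => u Fu us.
have usn : `|u + tau - s| <= h by move: us; rewrite !ler_norml; lra.
have au : a <= u + tau by move: usn; rewrite ler_norml; lra.
have ub : u + tau <= b by move: usn; rewrite ler_norml; lra.
have ut : `|u + tau - t| <= 2 * h.
  by move: usn st; rewrite !ler_norml; lra.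
have := Fu (interval_between aI bI au ub).
rewrite /tau (periodic_int n u FT) -/tau => Fu'.
rewrite /wave Fu' /expi /= -cosB; apply: cos_ge_half.
apply: le_trans (ph _ au ub ut); rewrite le_eqVlt; apply/orP; left; apply/eqP.
by congr (`| _ |); ring.
Qed.

(** * Exponentials of a nonlinear phase *)

Unset Implicit Arguments.
Set Strict Implicit.

Theorem mainTheorem2 (R : realType) (p : R) (omega : R -> R)
    (I : interval R) (phi : R -> R)
    (hp : 1 <= p < 2)
    (homega_cont : {within [set x : R | 0 <= x], continuous omega})
    (homega_mono : forall x y : R, 0 <= x -> x <= y -> omega x <= omega y)
    (homega0 : omega 0 = 0)
    (hI : (lebesgue_measure [set` I] < (2 * pi)%:E)%E)
    (hphi_nonlinear : ~ linear_on [set` I] phi)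
    (hphi_C1 : C1_omega omega [set` I] phi) :
  exists c : R, 0 < c /\
    forall lambda : R, 1 <= `|lambda| ->
      ((c * (`|lambda| `^ p^-1) * chi_inv omega (`|lambda|^-1))%:E
        <= Ap_norm_on p [set` I] (fun t => expi (lambda * phi t)))%E.
Proof.
case: hphi_C1 => dg [hg Lg].
have [a0 [b0 [a0I b0I ab0 dab0]]] := nonlinear_slopes hg hphi_nonlinear.
have opos := Lip_omega_gt0 homega_mono homega0 Lg a0I b0I dab0.
have [n [a [b [aI bI ab dab [na bn]]]]] := slopes_in_period hI a0I b0I ab0 dab0.
have cdg := Lip_omega_continuous homega_cont homega0 Lg aI bI.
have [C [d [d0 hC]]] := Lip_omegaP Lg.
have /andP[p1 _] := hp.
have p0 : 0 < p by apply: lt_le_trans p1.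
have pi0 := pi_gt0 R.
have pV : 0 < p^-1 by rewrite invr_gt0.
pose D := Num.max 1 (omega 1)^-1.
have D1 : 1 <= D by rewrite le_max lexx.
have D0 : 0 < D by apply: lt_le_trans D1.
(* With kap * D <= m, the window width 2h = kap * del is below d, so that the
   modulus estimate applies; it is at most 1/2, which absorbs |k - v| <= 1; and
   it fits into the segment from a to b. *)
pose m := Num.min (Num.min (d / 2) 2^-1) (b - a).
have m0 : 0 < m by rewrite !lt_min divr_gt0 // invr_gt0 ltr0n subr_gt0 ab.
have C0 : 0 < 2 * (`|C| + 1) by rewrite mulr_gt0 // ltr_wpDl.
pose kap := Num.min (Num.min 1 (2 * (`|C| + 1))^-1) (m / D).
have k0 : 0 < kap by rewrite !lt_min ltr01 invr_gt0 C0 divr_gt0.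
have k1 : kap <= 1 by rewrite !ge_min lexx.
have kC : kap <= (2 * (`|C| + 1))^-1 by rewrite !ge_min lexx !orbT.
have kD : kap * D <= m by rewrite -ler_pdivlMr // !ge_min lexx !orbT.
have dd0 : 0 < `|dg b - dg a| by rewrite normr_gt0 subr_eq0 eq_sym.
exists (`|dg b - dg a| `^ p^-1 * (kap / (64 * pi))); split.
  by rewrite mulr_gt0 ?powR_gt0 // divr_gt0 // mulr_gt0.
move=> lambda l1; have l0 : 0 < `|lambda| by apply: lt_le_trans l1.
have [|| del0 delD delE] := chi_invP homega_cont homega_mono opos (y := `|lambda|^-1).
- by rewrite invr_gt0.
- by rewrite invf_le1.
set del := chi_inv omega _ in del0 delD delE *.
pose h := kap * del / 2.
have h0 : 0 < h by rewrite divr_gt0 // mulr_gt0.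
have h2 : 2 * h = kap * del by rewrite /h mulrC divfK.
have hm : 2 * h <= m by rewrite h2; apply: le_trans kD; rewrite ler_wpM2l // ltW.
have [hd hh hab] : [/\ 2 * h <= d / 2, 2 * h <= 2^-1 & 2 * h <= b - a].
  by move: hm; rewrite !le_min => /andP[/andP[]].
have h2del : 2 * h <= del by rewrite h2 ler_piMl // ltW.
have hpi : h <= 2 * pi by have := pi_ge2 R; lra.
have [K [uK sK hK]] := @integer_frequencies R
  (Num.min (lambda * dg a) (lambda * dg b)) (`|lambda| * `|dg b - dg a|)
  (mulr_ge0 (normr_ge0 _) (normr_ge0 _)).
apply: le_ereal_inf_tmp => _ [F [FA Fr] <-].
have FI := restricts_to_ae Fr.
have FT : periodic F (2 * pi) by case: FA.
have := @Ap_norm_ge R p h F K p1 (Ap_integrable FA) h0 hpi uK.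
have res k : k \in K -> exists theta s, [/\ h <= s, s <= 2 * pi - h &
    {ae lebesgue_measure, forall u : R, `|u - s| <= h ->
      2^-1 <= wave (fun t => complex.Re (F t)) (fun t => complex.Im (F t)) k theta u}].
  move=> kK; have [v vb kv] := hK k kK.
  have cl : {within `[a, b], continuous (fun t => lambda * dg t)}.
    by move=> z; apply: cvgM; [exact: cvg_cst|exact: cdg].
  have [|t] := IVT (ltW ab) cl (v := v).
    have -> : Num.max (lambda * dg a) (lambda * dg b) =
       Num.min (lambda * dg a) (lambda * dg b) + `|lambda| * `|dg b - dg a|.
      rewrite -normrM mulrBr.
      have [E|E] := leP (lambda * dg a) (lambda * dg b).
        by rewrite ger0_norm ?subr_ge0 // addrC subrK.
      by rewrite ltr0_norm ?subr_lt0 // opprB addrC subrK.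
    exact: vb.
  rewrite in_itv /= => /andP[at_ tb] tv.
  apply: (resonant_window FT FI aI bI na bn at_ tb h0 hab) => u au ub ut.
  (* The phase splits into the deviation from the tangent line at t and the
     frequency mismatch k - v; each contributes at most 1/2. *)
  have slope : `|phi u - phi t - dg t * (u - t)| <= C * omega (2 * h) * `|u - t|.
    have uI := interval_between aI bI au ub.
    have tI := interval_between aI bI at_ tb.
    have bd w : w \in I -> `|w - t| <= 2 * h -> `|dg w - dg t| <= C * omega (2 * h).
      move=> wI wt; apply: hC => //; first by rewrite mulr_gt0.
      by apply: le_lt_trans hd _; rewrite ltr_pdivrMr // ltr_pMr // ltr1n.
    have [tu|/ltW ut'] := leP t u.
      have [w /andP[w1 w2] ->] := MVT_on hg tI uI tu.
      rewrite -mulrBl normrM ler_wpM2r //; apply: bd.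
        exact: interval_between w1 w2.
      by move: ut; rewrite !ler_norml; lra.
    have [w /andP[w1 w2] E] := MVT_on hg uI tI ut'.
    have -> : phi u - phi t - dg t * (u - t) = (dg w - dg t) * (u - t).
      by rewrite -[phi u - _]opprB E; ring.
    rewrite normrM ler_wpM2r //; apply: bd.
      exact: interval_between w1 w2.
    by move: ut; rewrite !ler_norml; lra.
  have e1 : `|lambda * (phi u - phi t - dg t * (u - t))| <= 2^-1.
    rewrite normrM.
    have om0 : 0 <= omega (2 * h) by rewrite -homega0 homega_mono // mulr_ge0 // ltW.
    have om1 : omega (2 * h) <= omega del by apply: homega_mono => //; rewrite mulr_ge0 // ltW.
    apply: (@le_trans _ _ (`|lambda| * ((`|C| + 1) * omega del * (kap * del)))).
      rewrite ler_wpM2l //; apply: le_trans slope _.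
      apply: (@le_trans _ _ ((`|C| + 1) * omega del * `|u - t|)).
        rewrite ler_wpM2r //; apply: (@le_trans _ _ ((`|C| + 1) * omega (2 * h))).
          by rewrite ler_wpM2r // (le_trans (ler_norm _)) // lerDl.
        by rewrite ler_wpM2l // addr_ge0.
      rewrite ler_wpM2l -?h2 // mulr_ge0 ?addr_ge0 //.
      exact: le_trans om1.
    have -> : `|lambda| * ((`|C| + 1) * omega del * (kap * del)) = (`|C| + 1) * kap.
      transitivity ((`|C| + 1) * kap * (`|lambda| * (del * omega del))); first by ring.
      by rewrite delE divff ?mulr1 // lt0r_neq0.
    move: kC; rewrite -(ler_pM2l C0) divff ?lt0r_neq0 //; lra.
  have e2 : `|(k%:~R - v) * (u - t)| <= 2^-1.
    rewrite normrM; apply: (@le_trans _ _ (1 * `|u - t|)); first by rewrite ler_wpM2r.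
    by rewrite mul1r; apply: le_trans ut _.
  have -> : lambda * phi u - lambda * phi t - k%:~R * (u - t) =
     lambda * (phi u - phi t - dg t * (u - t)) - (k%:~R - v) * (u - t).
    by rewrite -tv; ring.
  apply: le_trans (ler_normB _ _) _; lra.
move=> /(_ res); apply: le_trans; rewrite lee_fin.
have -> : h / (32 * pi) = kap / (64 * pi) * del.
  rewrite /h; move: (lt0r_neq0 pi0); move: (@pi R) => q q0; by field.
rewrite [leRHS]mulrA ler_wpM2r ?(ltW del0) //.
rewrite [leLHS]mulrAC ler_wpM2r //.
  by rewrite divr_ge0 ?(ltW k0) // mulr_ge0 // ltW.
by rewrite mulrC -powRM // ge0_ler_powR ?(ltW pV) // ?nnegrE //.
Qed.
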